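(* If $c$ is an even Markoff number, then $c \equiv 2 \pmod{32}$.
   Context: A Markoff triple is a triple $(a,b,c)$ of positive integers satisfying the Markoff equation $a^2+b^2+c^2=3abc$. A Markoff number is a positive integer that occurs as an element of some Markoff triple. *)

(* Defs.v *)
From mathcomp Require Import all_boot.

Set Implicit Arguments.
Unset Strict Implicit.
Unset Printing Implicit Defensive.

Definition markoff_triple (a b c : nat) : Prop :=
  [/\ 0 < a, 0 < b, 0 < c & a ^ 2 + b ^ 2 + c ^ 2 = 3 * a * b * c].

Definition markoff_number (m : nat) : Prop :=
  exists a b c : nat, markoff_triple a b c /\ m \in [:: a; b; c].

(* Main.v *)
Require Import Defs.
From mathcomp Require Import all_boot cyclic.
From mathcomp Require Import zify.

(** Let [c] be the even entry of a Markoff triple [(a, b, c)].  A 2-adic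
    descent ([even_sum_sq_descent]) shows that [a] and [b] are odd, and then the
    equation read modulo 4 gives [c = 2 d] with [d = 2 e + 1] odd.
    Completing the square in the Markoff equation in two ways,
      [(a - b)^2 + c^2 = a b (3 c - 2)]  and  [(a + b)^2 + c^2 = a b (3 c + 2)],
    and dividing by 4, one finds that the consecutive integers [m = 3 e + 1] and
    [m + 1] both divide a sum of two squares one of which is [d^2].  As
    [3 d = 2 m + 1 = 2 (m + 1) - 1], both are coprime to [d].

    A number that divides [x^2 + d^2] and is coprime to [d] has no prime factor
    congruent to 3 modulo 4, because -1 is not a square modulo such a prime; and
    as [d] is odd it is not divisible by 4.  It is therefore a product of primes
    congruent to 1 modulo 4, or twice such a product, so it is 1, 2 or 5 modulo
    8 ([sum_sq_divisor_mod8]).  The only way for [m] and [m + 1] both to be of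
    this kind is [m = 1] modulo 8, so 8 divides [e]
    ([dvd8_of_sum_sq_divisors]), and [c = 4 e + 2] is 2 modulo 32. *)

(** Follows by a two-step induction from the recurrence
    [u^(n+2) + v^(n+2) + u v (u^n + v^n) = (u + v) (u^(n+1) + v^(n+1))]. *)
Lemma dvdn_add_exp_odd (u v n : nat) : odd n -> u + v %| u ^ n + v ^ n.
Proof.
elim/ltn_ind: n => -[|[|n]] IH on; [by [] | by rewrite !expn1 |].
have dn : u + v %| u ^ n + v ^ n by apply: IH => //; rewrite -(negbK (odd n)).
rewrite -(dvdn_addl _ (dvdn_mull (u * v) dn)).
have -> : u ^ n.+2 + v ^ n.+2 + u * v * (u ^ n + v ^ n)
        = (u + v) * (u ^ n.+1 + v ^ n.+1) by rewrite !expnS; lia.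
exact: dvdn_mulr.
Qed.

(** Otherwise [x] and [y] are units modulo [p].  As [p.-1] is twice an odd
    number, [x ^ 2 + y ^ 2] divides [x ^ p.-1 + y ^ p.-1], which by Fermat's
    little theorem is 2 modulo [p]. *)
Lemma prime3mod4_dvd_sum_sq (p x y : nat) :
  prime p -> p %% 4 = 3 -> p %| x ^ 2 + y ^ 2 -> p %| y.
Proof.
move=> pr_p p3 pxy; apply/negPn/negP => npy.
have npx : ~~ (p %| x).
  apply: contra npy => px.
  by move: pxy; rewrite dvdn_addr ?Euclid_dvdX ?px // andbT.
have fermat z : ~~ (p %| z) -> z ^ p.-1 = 1 %[mod p].
  by move=> npz; rewrite -totient_prime // Euler_exp_totient // coprime_sym
    prime_coprime.
have Ep : p.-1 = 2 * (p %/ 4).*2.+1.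
  by rewrite {1}(divn_eq p 4) p3 addnS /= -mul2n; lia.
have : p %| x ^ p.-1 + y ^ p.-1.
  apply: dvdn_trans pxy _.
  by rewrite Ep !expnM dvdn_add_exp_odd //= odd_double.
rewrite /dvdn -modnDm !fermat // modnDm -/(dvdn p 2).
by move/dvdn_leq=> /(_ isT); lia.
Qed.

(** All prime factors of [m] are odd, and they cannot all be 1 modulo 4, since
    their product would be 1 as well. *)
Lemma prime3mod4_divisor (m : nat) :
  m %% 4 = 3 -> exists p, [/\ prime p, p %| m & p %% 4 = 3].
Proof.
elim/ltn_ind: m => m IH m3.
have m_gt1 : 1 < m by lia.
have pr_q := pdiv_prime m_gt1.
have [q3 | q3] := eqVneq (pdiv m %% 4) 3.
  by exists (pdiv m); split=> //; apply: pdiv_dvd.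
have Em := divnK (pdiv_dvd m).
set q := pdiv m in pr_q q3 Em *; set k := m %/ q in Em *.
have q_gt1 := prime_gt1 pr_q.
have k3 : k %% 4 = 3.
  have : (k %% 4) * (q %% 4) = 3 %[mod 4] by rewrite modnMm Em m3.
  have : k %% 4 < 4 by rewrite ltn_mod.
  have : q %% 4 < 4 by rewrite ltn_mod.
  by move: (k %% 4) (q %% 4) q3 => [|[|[|[|?]]]] [|[|[|[|?]]]].
have [|p [pr_p pk p3]] := IH k _ k3.
  by rewrite -Em ltn_Pmulr //; lia.
by exists p; split=> //; rewrite -Em dvdn_mulr.
Qed.

Lemma sum_sq_divisor_odd (m x y : nat) :
  coprime m y -> m %| x ^ 2 + y ^ 2 -> odd m -> m %% 4 = 1.
Proof.
move=> co_my dm om; have [m3 | m3] := eqVneq (m %% 4) 3; last by lia.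
have [p [pr_p pm p3]] := prime3mod4_divisor m m3.
have py := prime3mod4_dvd_sum_sq p x y pr_p p3 (dvdn_trans pm dm).
have := coprime_dvdl pm co_my.
by rewrite prime_coprime // py.
Qed.

(** For [y] odd, [x ^ 2 + y ^ 2] is 1 or 2 modulo 4, so the 2-part of a divisor
    is at most 2. *)
Lemma sum_sq_divisor_mod8 (m x y : nat) :
  odd y -> coprime m y -> m %| x ^ 2 + y ^ 2 -> m %% 8 \in [:: 1; 2; 5].
Proof.
move=> oy co_my dm; rewrite !inE.
have [om | em] := boolP (odd m).
  by have := sum_sq_divisor_odd m x y co_my dm om; lia.
have Em : m = m./2 * 2 by lia.
have hm : m./2 %| m by rewrite {2}Em dvdn_mulr.
have n4m : ~~ (4 %| m).
  apply/negP => /dvdn_trans/(_ dm)/dvdnP[k Ek].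
  have Ex : x = odd x + x./2.*2 by rewrite odd_double_half.
  have Ey : y = 1 + y./2.*2 by rewrite -{1}(odd_double_half y) oy.
  by move: Ek; rewrite Ex Ey -!mulnn -!mul2n; case: (odd x); lia.
have oh : odd m./2 by lia.
have := sum_sq_divisor_odd _ x y (coprime_dvdl hm co_my) (dvdn_trans hm dm) oh.
by lia.
Qed.

(** Both [3 e + 1] and [3 e + 2] are coprime to [2 e + 1], so both are 1, 2 or 5
    modulo 8; being consecutive, they must be 1 and 2. *)
Lemma dvd8_of_sum_sq_divisors (e x y : nat) :
  3 * e + 1 %| x ^ 2 + (2 * e + 1) ^ 2 -> 3 * e + 2 %| y ^ 2 + (2 * e + 1) ^ 2 ->
  8 %| e.
Proof.
have co1 : coprime (3 * e + 1) (2 * e + 1).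
  apply: (@coprime_dvdr _ (3 * (2 * e + 1))); first exact: dvdn_mull.
  have -> : 3 * (2 * e + 1) = 2 * (3 * e + 1) + 1 by lia.
  by rewrite /coprime gcdnMDl gcdn1.
have co2 : coprime (3 * e + 2) (2 * e + 1).
  (* Bezout's identity [2 (3 e + 2) - 3 (2 e + 1) = 1]. *)
  by apply/coprimeP; [rewrite addn2 | exists (2, 3) => /=; lia].
have od : odd (2 * e + 1) by rewrite addn1 /= mul2n odd_double.
move=> /(sum_sq_divisor_mod8 _ _ _ od co1) m1 /(sum_sq_divisor_mod8 _ _ _ od co2).
by move: m1; rewrite !inE; clear; lia.
Qed.

(** The right-hand side is even, so an even number of the entries are odd;
    exactly two odd entries would make the left-hand side 2 and the right-hand side 0
    modulo 4.  Hence all entries are even, and halving them gives a smaller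
    solution, with [k] doubled. *)
Lemma even_sum_sq_descent (k a b c : nat) :
  a ^ 2 + b ^ 2 + c ^ 2 = 2 * k * (a * b * c) -> a = 0.
Proof.
elim/ltn_ind: a k b c => a IH k b c E.
have Ea := odd_double_half a; have Eb := odd_double_half b.
have Ec := odd_double_half c.
move: (a./2) (b./2) (c./2) Ea Eb Ec => a' b' c'.
case: (odd a) (odd b) (odd c) => [] [] [] /= Ea Eb Ec; subst a b c;
  try by (exfalso; move: E; rewrite -!mulnn -!mul2n; lia).
case: (posnP a') => [-> // | a_gt0].
have E' : a' ^ 2 + b' ^ 2 + c' ^ 2 = 2 * (2 * k) * (a' * b' * c').
  by move: E; rewrite -!mulnn -!mul2n; lia.
have lt_a : a' < a'.*2 by lia.
by have := IH a' lt_a _ _ _ E'; lia.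
Qed.

Lemma markoff_triple_odd (a b c : nat) :
  markoff_triple a b c -> ~~ odd c -> odd a && odd b.
Proof.
case=> a_gt0 b_gt0 c_gt0 E ev.
have Ec : c = c./2.*2 by lia.
have eq_ab : odd a = odd b.
  by move/(congr1 odd): E; rewrite !oddD !oddM (negPf ev) !andbF; do 2!case: odd.
rewrite -eq_ab andbb; apply/negPn/negP => ea.
have Ea : a = a./2.*2 by lia.
have Eb : b = b./2.*2 by move: ea; rewrite eq_ab; lia.
have E' : (a./2) ^ 2 + (b./2) ^ 2 + (c./2) ^ 2
        = 2 * 3 * ((a./2) * (b./2) * (c./2)).
  by move: E; rewrite Ea Eb Ec !doubleK -!mulnn -!mul2n; lia.
by have := even_sum_sq_descent 3 _ _ _ E'; lia.
Qed.

Lemma markoff_triple_even_last (a b c : nat) :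
  markoff_triple a b c -> ~~ odd c -> c = 2 %[mod 32].
Proof.
wlog le_ba : a b / b <= a => [hwlog T | T ev].
  have [/hwlog | /ltnW/hwlog] := leqP b a; apply=> //.
  by case: T => a_gt0 b_gt0 c_gt0 E; split=> //; rewrite (addnC (b ^ 2)) E; lia.
have /andP[oa ob] := markoff_triple_odd a b c T ev.
case: T => a_gt0 b_gt0 c_gt0 E.
have n4c : c %% 4 != 0.
  apply/negP => c4; move: E.
  have -> : a = 1 + 2 * a./2 by lia.
  have -> : b = 1 + 2 * b./2 by lia.
  have -> : c = 4 * (c %/ 4) by lia.
  by rewrite -!mulnn; lia.
(* With [c = 4 e + 2], the divisors [(3 c - 2) / 4] and [(3 c + 2) / 4] become
   [3 e + 1] and [3 e + 2]; the half-sum of [a] and [b] is [b + x]. *)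
pose e := c %/ 4; pose x := (a - b)./2; pose d := 2 * e + 1.
have Ec : c = 2 * d by rewrite /d /e; lia.
have Ea : a = b + 2 * x by rewrite /x; lia.
have dm : 3 * e + 1 %| x ^ 2 + d ^ 2.
  apply/dvdnP; exists (a * b).
  by move: E; rewrite Ec Ea /d -!mulnn; lia.
have dm1 : 3 * e + 2 %| (b + x) ^ 2 + d ^ 2.
  apply/dvdnP; exists (a * b).
  by move: E; rewrite Ec Ea /d -!mulnn; lia.
have /dvdnP[k Ek] := dvd8_of_sum_sq_divisors e x (b + x) dm dm1.
have {}Ec : c = k * 32 + 2 by rewrite Ec /d Ek; clear; lia.
by rewrite Ec modnMDl.
Qed.

Theorem theorem1 (c : nat) (hc : markoff_number c) (hev : ~~ odd c) :
  c = 2 %[mod 32].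
Proof.
case: hc => x [y [z [[x_gt0 y_gt0 z_gt0 E]]]].
rewrite !inE => /or3P[] /eqP Ec; subst c.
- by apply: (markoff_triple_even_last y z) hev; split=> //; lia.
- by apply: (markoff_triple_even_last x z) hev; split=> //; lia.
- exact: (markoff_triple_even_last x y).
Qed.
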